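(* Let $\mathbf{X}$ be a random vector in $\mathbb{R}^d$, $u:\mathbb{R}^d\to\mathbb{R}$ continuously differentiable, and $\Phi\in C^1(\mathbb{R}^d,\mathbb{R}^K)$. Then for any $G\in\mathbb{R}^K$, $$\mathcal{L}_1(G^T\Phi)=G^THG,$$ where $H:=H^{(1)}-H^{(2)}\in\mathbb{R}^{K\times K}$ is a positive semi-definite matrix, with $$H^{(1)}:=\mathbb{E}\big[\|\nabla u(\mathbf{X})\|_2^2\,\nabla\Phi(\mathbf{X})^T\nabla\Phi(\mathbf{X})\big],\qquad H^{(2)}:=\mathbb{E}\big[\nabla\Phi(\mathbf{X})^T\nabla u(\mathbf{X})\nabla u(\mathbf{X})^T\nabla\Phi(\mathbf{X})\big].$$
   Context: $\nabla\Phi(\mathbf{x})=(\partial\Phi_j/\partial x_i(\mathbf{x}))_{1\le i\le d,1\le j\le K}\in\mathbb{R}^{d\times K}$. $G^T\Phi$ denotes the function $\mathbf{x}\mapsto G^T\Phi(\mathbf{x})$. For a vector $\mathbf{v}\in\mathbb{R}^d$, $\Pi^{\perp}_{\mathbf{v}}$ is the orthogonal projector of $\mathbb{R}^d$ onto $\mathrm{span}\{\mathbf{v}\}^\perp$, and for $g\in C^1(\mathbb{R}^d,\mathbb{R})$, $$\mathcal{L}_1(g):=\mathbb{E}\big[\|\nabla u(\mathbf{X})\|_2^2\,\|\Pi^{\perp}_{\nabla u(\mathbf{X})}\nabla g(\mathbf{X})\|_2^2\big].$$ It is assumed that the expectations defining $H^{(1)}$ and $H^{(2)}$ are finite, i.e.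 $\mathbb{E}[\|\nabla u(\mathbf{X})\|_2^2\|\nabla\Phi(\mathbf{X})\|_F^2]<\infty$. *)

(* Defs.v *)
From HB Require Import structures.
From mathcomp Require Export all_boot all_order all_algebra.
From mathcomp Require Export all_classical all_reals all_analysis.

Set Implicit Arguments.
Unset Strict Implicit.
Unset Printing Implicit Defensive.

Import Order.TTheory GRing.Theory Num.Theory.
Export numFieldNormedType.Exports.

Local Open Scope classical_set_scope.
Local Open Scope ring_scope.

(* Points of R^d and values of Phi are row vectors, as in the library's
   differential calculus; gradients and G are column vectors. *)

(* R^d with its Borel sigma-algebra. *)
Notation borelRd R d := (g_sigma_algebraType (@open 'rV[R]_d)).

Definition partial (R : realType) (d : nat) (V : normedModType R)
    (f : 'rV[R]_d -> V) (i : 'I_d) (x : 'rV[R]_d) : V :=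
  'D_(delta_mx 0 i) f x.

Definition C1 (R : realType) (d : nat) (V : normedModType R)
    (f : 'rV[R]_d -> V) : Prop :=
  (forall x, differentiable f x) /\ (forall i, continuous (partial f i)).

Definition grad (R : realType) (d : nat) (g : 'rV[R]_d -> R)
    (x : 'rV[R]_d) : 'cV[R]_d :=
  \col_i partial g i x.

Definition nabla (R : realType) (d K : nat) (Phi : 'rV[R]_d -> 'rV[R]_K)
    (x : 'rV[R]_d) : 'M[R]_(d, K) :=
  \matrix_(i, j) partial (fun y => Phi y 0 j) i x.

(* Frobenius norm, which on column vectors is the Euclidean norm (the norm of
   the library's normedModType structure on matrices is the sup norm). *)
Definition normF (R : realType) (m n : nat) (A : 'M[R]_(m, n)) : R :=
  Num.sqrt (\sum_i \sum_j A i j ^+ 2).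

(* Subspaces are row spaces, as in mxalgebra: the row space of [orthoc S] is
   the orthogonal complement of the row space of S. *)
Definition orthoc (R : realType) (m n : nat) (S : 'M[R]_(m, n)) : 'M[R]_n :=
  kermx S^T.

(* Orthogonal projector onto the row space of S, i.e. the projector onto it
   along its orthogonal complement. [proj_mx] acts on row vectors, hence the
   transposition: [orthoproj S *m w] is the projection of the column w. *)
Definition orthoproj (R : realType) (n : nat) (S : 'M[R]_n) : 'M[R]_n :=
  (proj_mx S (orthoc S))^T.

(* Projector onto span{v}^perp; it is the identity for v = 0. *)
Definition proj_perp (R : realType) (d : nat) (v : 'cV[R]_d) : 'M[R]_d :=
  orthoproj (orthoc v^T).

(* Entrywise expectation; only meaningful when the entries are integrable
   ([fine] sends infinite values to 0). *)
Definition Emx (dT : measure_display) (T : measurableType dT) (R : realType)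
    (P : probability T R) (m n : nat) (M : T -> 'M[R]_(m, n)) : 'M[R]_(m, n) :=
  \matrix_(i, j) fine 'E_P[fun w => M w i j].

Definition psd (R : realType) (n : nat) (A : 'M[R]_n) : Prop :=
  A^T = A /\ forall v : 'cV[R]_n, 0 <= (v^T *m A *m v) 0 0.

Section Loss.
Context (dT : measure_display) (T : measurableType dT) (R : realType).
Context (P : probability T R) (d K : nat) (X : T -> 'rV[R]_d).
Context (u : 'rV[R]_d -> R).

Definition L1 (g : 'rV[R]_d -> R) : \bar R :=
  'E_P[fun w => normF (grad u (X w)) ^+ 2 *
                normF (proj_perp (grad u (X w)) *m grad g (X w)) ^+ 2].

Definition H1 (Phi : 'rV[R]_d -> 'rV[R]_K) : 'M[R]_K :=
  Emx P (fun w => normF (grad u (X w)) ^+ 2 *: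
                  ((nabla Phi (X w))^T *m nabla Phi (X w))).

Definition H2 (Phi : 'rV[R]_d -> 'rV[R]_K) : 'M[R]_K :=
  Emx P (fun w => (nabla Phi (X w))^T *m grad u (X w) *m
                  (grad u (X w))^T *m nabla Phi (X w)).

End Loss.

(* x |-> G^T Phi(x). *)
Definition lincomb (R : realType) (d K : nat) (G : 'cV[R]_K)
    (Phi : 'rV[R]_d -> 'rV[R]_K) (x : 'rV[R]_d) : R :=
  (G^T *m (Phi x)^T) 0 0.

(* Main.v *)
Require Import Defs.
From mathcomp Require Import ring measurable_realfun.

Set Implicit Arguments.
Unset Strict Implicit.
Unset Printing Implicit Defensive.

Import Order.TTheory GRing.Theory Num.Theory.

Local Open Scope classical_set_scope.
Local Open Scope ring_scope.

(** Fix a point and write v for the gradient of u and J for the Jacobian [nabla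
    Phi] there. The gradient of x |-> G^T Phi(x) is w = J G ([grad_lincomb]).
    If v is nonzero, the projection of w onto the orthogonal complement of v is
    w - (<v, w> / <v, v>) v ([proj_perpE]), so that
      |v|^2 |Pi w|^2 = |v|^2 |w|^2 - <v, w>^2   ([sqr_proj_perp]),
    which also holds, trivially, for v = 0: the weight |v|^2 makes the value of
    the projector irrelevant there. The right-hand side is the quadratic form
    at G of the matrix |v|^2 J^T J - J^T v v^T J ([quad_loss]).

    Taking expectations commutes with the quadratic form as soon as the
    entries of the two random matrices are integrable ([expectation_quad],
    [EmxB]). These entries are measurable because all first partial derivatives
    are continuous, and by the Cauchy-Schwarz inequality, itself a consequence
    of [sqr_proj_perp], they are bounded by |v|^2 |J|_F^2, whose expectation is
    finite by assumption. Hence L1(G^T Phi) = G^T H G; in particular the form is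
    nonnegative, being the expectation of a nonnegative function, and H is
    symmetric because the random matrices are. *)

(** * Euclidean geometry of column vectors *)

(** The Euclidean inner product of two columns. *)
Definition dot (R : realType) (n : nat) (v w : 'cV[R]_n) : R :=
  (v^T *m w) 0 0.

Lemma dotE (R : realType) (n : nat) (v w : 'cV[R]_n) :
  dot v w = \sum_i v i 0 * w i 0.
Proof. by rewrite /dot mxE; apply: eq_bigr => i _; rewrite mxE. Qed.

(** The entries of [A^T *m B] are the inner products of the columns. *)
Lemma mulmx_trcE (R : realType) (n p q : nat) (A : 'M[R]_(n, p))
    (B : 'M[R]_(n, q)) i j :
  (A^T *m B) i j = dot (col i A) (col j B).
Proof. by rewrite dotE mxE; apply: eq_bigr => k _; rewrite !mxE. Qed.

Lemma dotC (R : realType) (n : nat) (v w : 'cV[R]_n) : dot v w = dot w v.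
Proof. by rewrite !dotE; apply: eq_bigr => i _; rewrite mulrC. Qed.

Lemma mx11_dot (R : realType) (n : nat) (v w : 'cV[R]_n) :
  v^T *m w = (dot v w)%:M.
Proof. exact: mx11_scalar. Qed.

Lemma sqr_normFE (R : realType) (m n : nat) (A : 'M[R]_(m, n)) :
  normF A ^+ 2 = \sum_i \sum_j A i j ^+ 2.
Proof.
rewrite sqr_sqrtr// sumr_ge0// => i _; rewrite sumr_ge0// => j _.
exact: sqr_ge0.
Qed.

Lemma sqr_normF_dot (R : realType) (n : nat) (v : 'cV[R]_n) :
  normF v ^+ 2 = dot v v.
Proof.
by rewrite sqr_normFE dotE; apply: eq_bigr => i _; rewrite big_ord1 expr2.
Qed.

Lemma dotvv_eq0 (R : realType) (n : nat) (v : 'cV[R]_n) :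
  dot v v = 0 -> v = 0.
Proof.
rewrite dotE => /eqP; rewrite psumr_eq0 => [/allP v0|i _]; last first.
  by rewrite -expr2 sqr_ge0.
apply/matrixP => i j; rewrite ord1 mxE.
by have := v0 i (mem_index_enum i); rewrite -expr2 sqrf_eq0 => /eqP.
Qed.

Lemma sqr_normF_col_le (R : realType) (m n : nat) (A : 'M[R]_(m, n)) j :
  normF (col j A) ^+ 2 <= normF A ^+ 2.
Proof.
rewrite !sqr_normFE ler_sum// => i _; rewrite big_ord1 mxE (bigD1 j)//= lerDl.
by rewrite sumr_ge0// => k _; rewrite sqr_ge0.
Qed.

(** A real inner product is anisotropic, so a subspace and its orthogonal
    complement are in direct sum; the projector of [orthoproj] is therefore the
    expected one. *)
Lemma capmx_orthoc (R : realType) (n : nat) (S : 'M[R]_n) :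
  (S :&: orthoc S)%MS = 0.
Proof.
apply/eqP/rowV0P => x; rewrite sub_capmx => /andP[/submxP[y xE]].
move=> /sub_kermxP xS0; apply: trmx_inj; rewrite trmx0.
apply: dotvv_eq0; rewrite /dot trmxK {2}xE trmx_mul mulmxA xS0 mul0mx.
by rewrite mxE.
Qed.

(** For [v != 0] the projection onto the orthogonal complement of [v] removes
    the component along [v]. *)
Lemma proj_perpE (R : realType) (d : nat) (v w : 'cV[R]_d) : v != 0 ->
  proj_perp v *m w = w - (dot v w / dot v v) *: v.
Proof.
move=> v0; have vv0 : dot v v != 0 by apply: contra_neq v0 => /dotvv_eq0.
set c := _ / _; rewrite /proj_perp /orthoproj; set S := orthoc v^T.
rewrite -[LHS]trmxK trmx_mul trmxK -[RHS]trmxK; congr (_^T).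
(* Decompose w as a part orthogonal to v plus a multiple of v. *)
have -> : w^T = (w - c *: v)^T + (c *: v)^T by rewrite -linearD subrK.
have dS := capmx_orthoc S.
have pS : ((w - c *: v)^T <= S)%MS.
  apply/sub_kermxP; rewrite trmxK mx11_dot; apply/matrixP => i j.
  rewrite !ord1 !mxE eqxx mulr1n dotC /dot mulmxBr -scalemxAr !mx11_dot.
  by rewrite !mxE !eqxx !mulr1n /c mulfVK ?subrr.
have qS : ((c *: v)^T <= orthoc S)%MS.
  apply/sub_kermxP; rewrite -trmx_mul -scalemxAr.
  by rewrite -[v in X in _ *: X]trmxK -/S mulmx_ker scaler0 trmx0.
by rewrite mulmxDl (proj_mx_id dS pS) (proj_mx_0 dS qS) addr0.
Qed.

(** Both sides vanish for [v = 0]. *)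
Lemma sqr_proj_perp (R : realType) (d : nat) (v w : 'cV[R]_d) :
  normF v ^+ 2 * normF (proj_perp v *m w) ^+ 2 =
  dot v v * dot w w - dot v w ^+ 2.
Proof.
rewrite !sqr_normF_dot; have [->|v0] := eqVneq v 0.
  by rewrite /dot trmx0 !mul0mx mxE expr2 !mul0r subrr.
have vv0 : dot v v != 0 by apply: contra_neq v0 => /dotvv_eq0.
rewrite proj_perpE//; set c := _ / _.
have -> : dot (w - c *: v) (w - c *: v) =
    dot w w - c * dot v w *+ 2 + c ^+ 2 * dot v v.
  rewrite -(dotC w v) mulr2n {2}(dotC w v) !dotE opprD addrA.
  rewrite !mulr_sumr -!sumrB -big_split/=; apply: eq_bigr => i _.
  by rewrite !mxE; ring.
by rewrite /c; field.
Qed.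

Lemma cauchy_schwarz_dot (R : realType) (n : nat) (v w : 'cV[R]_n) :
  `|dot v w| <= normF v * normF w.
Proof.
have v0 : 0 <= normF v by apply: sqrtr_ge0.
have w0 : 0 <= normF w by apply: sqrtr_ge0.
rewrite -ler_sqr ?nnegrE ?normr_ge0 ?mulr_ge0// real_normK ?num_real//.
by rewrite exprMn !sqr_normF_dot -subr_ge0 -sqr_proj_perp mulr_ge0 ?sqr_ge0.
Qed.

Lemma dot_col_le (R : realType) (d K : nat) (J : 'M[R]_(d, K)) i
    (v : 'cV[R]_d) : `|dot (col i J) v| <= normF J * normF v.
Proof.
apply: le_trans (cauchy_schwarz_dot _ _) _.
rewrite ler_wpM2r ?sqrtr_ge0// -ler_sqr ?nnegrE ?sqrtr_ge0//.
exact: sqr_normF_col_le.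
Qed.

(** * Gradients *)

(** The derivative of a vector-valued map is taken coordinatewise. *)
Lemma partial_coord (R : realType) (d K : nat) (Phi : 'rV[R]_d -> 'rV[R]_K)
    (i : 'I_d) (j : 'I_K) x : differentiable Phi x ->
  partial (fun y => Phi y 0 j) i x = partial Phi i x 0 j.
Proof.
move=> dPhi; rewrite /partial derive_mx ?mxE//.
exact: diff_derivable.
Qed.

Lemma grad_lincomb (R : realType) (d K : nat) (Phi : 'rV[R]_d -> 'rV[R]_K)
    (G : 'cV[R]_K) x : differentiable Phi x ->
  grad (lincomb G Phi) x = nabla Phi x *m G.
Proof.
move=> dPhi; apply/matrixP => i j; rewrite ord1 !mxE {j}.
have -> : lincomb G Phi = \sum_j (G j 0 \*: (fun y => Phi y 0 j)).
  apply/funext => y; rewrite /lincomb mxE fct_sumE; apply: eq_bigr => j _.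
  by rewrite !mxE.
have dj j : derivable (fun y => Phi y 0 j) x (delta_mx 0 i).
  by apply: (derivable_mxP _ _ _).1; exact: diff_derivable.
rewrite /partial derive_sum => [|j]; last exact: derivableZ.
by apply: eq_bigr => j _; rewrite deriveZ// mxE mulrC.
Qed.

(** * Measurability *)

Lemma continuous_borelRd_measurable (R : realType) (d : nat)
    (f : 'rV[R]_d -> R) : continuous f ->
  measurable_fun [set: borelRd R d] (f : borelRd R d -> R).
Proof.
move=> /continuousP cf; apply: (measurability _ (RGenOpens.measurableE R)).
move=> _ [_ [a [b ->] <-]]; rewrite setTI.
by apply: sub_sigma_algebra; exact/cf/interval_open.
Qed.

Lemma grad_measurable (R : realType) (d : nat) (u : 'rV[R]_d -> R) i j :
  C1 u ->
  measurable_fun [set: borelRd R d] (fun x : borelRd R d => grad u x i j).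
Proof.
move=> [_ cu]; apply: continuous_borelRd_measurable.
by under eq_fun do rewrite mxE; exact: cu.
Qed.

Lemma nabla_measurable (R : realType) (d K : nat)
    (Phi : 'rV[R]_d -> 'rV[R]_K) i j : C1 Phi ->
  measurable_fun [set: borelRd R d] (fun x : borelRd R d => nabla Phi x i j).
Proof.
move=> [dPhi cPhi]; apply: continuous_borelRd_measurable.
under eq_fun do rewrite mxE partial_coord//.
move=> x; apply: (@continuous_comp _ _ _ (partial Phi i)
  (fun M : 'rV[R]_K => M 0 j)); first exact: cPhi.
exact: coord_continuous.
Qed.

Lemma dot_measurable (R : realType) (dT : measure_display)
    (T : measurableType dT) (n : nat) (v w : T -> 'cV[R]_n) :
  (forall i, measurable_fun setT (fun t => v t i 0)) ->
  (forall i, measurable_fun setT (fun t => w t i 0)) ->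
  measurable_fun setT (fun t => dot (v t) (w t)).
Proof.
move=> mv mw; under eq_fun do rewrite dotE.
by apply: measurable_sum => i; exact: measurable_funM.
Qed.

Lemma sqr_normF_measurable (R : realType) (dT : measure_display)
    (T : measurableType dT) (m n : nat) (A : T -> 'M[R]_(m, n)) :
  (forall i j, measurable_fun setT (fun t => A t i j)) ->
  measurable_fun setT (fun t => normF (A t) ^+ 2).
Proof.
move=> mA; under eq_fun do rewrite sqr_normFE.
by do 2 (apply: measurable_sum => ?); exact: measurable_funX.
Qed.

(** * Entrywise expectations *)

Lemma quadE (R : realType) (n : nat) (A : 'M[R]_n) (G : 'cV[R]_n) :
  (G^T *m A *m G) 0 0 = \sum_i \sum_j (G i 0 * G j 0) * A i j.
Proof.
rewrite -mulmxA mxE; apply: eq_bigr => i _; rewrite !mxE mulr_sumr.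
by apply: eq_bigr => j _; ring.
Qed.

(** The matrix whose expectation is H, as a quadratic form. *)
Lemma quad_loss (R : realType) (d K : nat) (v : 'cV[R]_d) (J : 'M[R]_(d, K))
    (G : 'cV[R]_K) :
  (G^T *m (normF v ^+ 2 *: (J^T *m J) - J^T *m v *m v^T *m J) *m G) 0 0 =
  dot v v * dot (J *m G) (J *m G) - dot v (J *m G) ^+ 2.
Proof.
rewrite mulmxBr mulmxBl -scalemxAr -scalemxAl mxE.
rewrite [X in X + _]mxE [X in _ + X]mxE sqr_normF_dot; congr (_ * _ - _).
  by rewrite /dot trmx_mul !mulmxA.
transitivity (((J *m G)^T *m v *m (v^T *m (J *m G))) 0 0).
  by rewrite trmx_mul !mulmxA.
by rewrite !mx11_dot mul_scalar_mx !mxE eqxx mulr1n dotC expr2.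
Qed.

(** Integrability of the entries of a random matrix. *)
Definition integrable_mx (dT : measure_display) (T : measurableType dT)
    (R : realType) (P : probability T R) (m n : nat)
    (M : T -> 'M[R]_(m, n)) : Prop :=
  forall i j, P.-integrable setT (fun w => (M w i j)%:E).

Lemma integrable_mxB (dT : measure_display) (T : measurableType dT)
    (R : realType) (P : probability T R) (m n : nat)
    (M N : T -> 'M[R]_(m, n)) :
  integrable_mx P M -> integrable_mx P N ->
  integrable_mx P (fun w => M w - N w).
Proof.
move=> iM iN i j; have := integrableB measurableT (iM i j) (iN i j).
by under [X in _ -> _.-integrable _ X]eq_fun
  do rewrite mxE [X in _ + X]mxE EFinB.
Qed.

Lemma EmxB (dT : measure_display) (T : measurableType dT) (R : realType)
    (P : probability T R) (m n : nat) (M N : T -> 'M[R]_(m, n)) :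
  integrable_mx P M -> integrable_mx P N ->
  Emx P (fun w => M w - N w) = Emx P M - Emx P N.
Proof.
move=> iM iN; apply/matrixP => i j; rewrite !mxE !unlock -fineB; last 2 first.
- exact: integrable_fin_num.
- exact: integrable_fin_num.
rewrite -integralB_EFin//; last 2 first.
- exact: iM.
- exact: iN.
by congr (fine _); apply: eq_integral => w _; rewrite !mxE EFinB.
Qed.

(** Expectation commutes with the evaluation of a quadratic form. *)
Lemma expectation_quad (dT : measure_display) (T : measurableType dT)
    (R : realType) (P : probability T R) (n : nat) (M : T -> 'M[R]_n)
    (G : 'cV[R]_n) : integrable_mx P M ->
  ('E_P[fun w => ((G^T *m M w *m G) 0 0)%R] =
   ((G^T *m Emx P M *m G) 0 0)%R%:E)%E.
Proof.
move=> iM; rewrite unlock quadE.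
have iZ i j :
    P.-integrable setT (fun w => ((G i 0 * G j 0)%:E * (M w i j)%:E)%E).
  exact: integrableZl.
under eq_integral do (rewrite quadE -sumEFin;
  under eq_bigr do (rewrite -sumEFin; under eq_bigr do rewrite EFinM)).
rewrite integral_sum// => [|i]; last exact: integrable_sum.
rewrite -sumEFin; apply: eq_bigr => i _; rewrite integral_sum//.
rewrite -sumEFin; apply: eq_bigr => j _; rewrite integralZl//.
by rewrite mxE [RHS]EFinM unlock fineK//; exact: integrable_fin_num.
Qed.

(** * The quadratic form *)

Theorem proposition4p11 (R : realType) (dT : measure_display)
    (T : measurableType dT) (P : probability T R) (d K : nat)
    (X : {RV P >-> borelRd R d})
    (u : 'rV[R]_d -> R) (Phi : 'rV[R]_d -> 'rV[R]_K)
    (u_C1 : C1 u) (Phi_C1 : C1 Phi)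
    (fin : ('E_P[fun w => (normF (grad u (X w)) ^+ 2 *
                           normF (nabla Phi (X w)) ^+ 2)%R] < +oo)%E) :
  let H := H1 P X u Phi - H2 P X u Phi in
  psd H /\
  forall G : 'cV[R]_K,
    L1 P X u (lincomb G Phi) = ((G^T *m H *m G) 0 0)%:E.
Proof.
move=> H.
pose v w := grad u (X w); pose J w := nabla Phi (X w).
have mv i : measurable_fun setT (fun w => v w i 0).
  by apply: (measurableT_comp (grad_measurable i 0 u_C1)).
have mJ i j : measurable_fun setT (fun w => J w i j).
  by apply: (measurableT_comp (nabla_measurable i j Phi_C1)).
have mJc i j : measurable_fun setT (fun w => col j (J w) i 0).
  by under eq_fun do rewrite mxE; exact: mJ.
have mv2 : measurable_fun setT (fun w => normF (v w) ^+ 2).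
  by apply: sqr_normF_measurable => i j; rewrite ord1.
pose b w := normF (v w) ^+ 2 * normF (J w) ^+ 2.
have b0 w : 0 <= b w by rewrite mulr_ge0 ?sqr_ge0.
have ib : P.-integrable setT (EFin \o b).
  apply/integrableP; split.
    by apply/measurable_EFinP/measurable_funM => //;
      exact: sqr_normF_measurable.
  move: fin; rewrite unlock; congr (_ < _)%E; apply: eq_integral => w _ /=.
  by rewrite ger0_norm.
(* Everything is dominated by the integrable function b. *)
have dom (f : T -> R) : measurable_fun setT f -> (forall w, `|f w| <= b w) ->
    P.-integrable setT (fun w => (f w)%:E).
  move=> mf fb; apply: (le_integrable measurableT _ _ ib).
    exact/measurable_EFinP.
  by move=> w _; rewrite lee_fin (ger0_norm (b0 w)).
pose M1 w := normF (v w) ^+ 2 *: ((J w)^T *m J w).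
pose M2 w := (J w)^T *m v w *m (v w)^T *m J w.
have M1E w i j : M1 w i j = normF (v w) ^+ 2 * dot (col i (J w)) (col j (J w)).
  by rewrite mxE mulmx_trcE.
have M2E w i j : M2 w i j = dot (col i (J w)) (v w) * dot (col j (J w)) (v w).
  rewrite /M2 -mulmxA mxE big_ord1 !mulmx_trcE [dot (col j _) _]dotC.
  have -> // : col 0 (v w) = v w by apply/matrixP => k l; rewrite mxE !ord1.
have iM1 : integrable_mx P M1.
  move=> i j; under eq_fun do rewrite M1E; apply: dom => [|w].
    by apply: measurable_funM => //; exact: dot_measurable.
  rewrite normrM ger0_norm ?sqr_ge0// ler_wpM2l ?sqr_ge0//.
  apply: le_trans (dot_col_le _ _ _) _; rewrite expr2 ler_wpM2l ?sqrtr_ge0//.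
  by rewrite -ler_sqr ?nnegrE ?sqrtr_ge0//; exact: sqr_normF_col_le.
have iM2 : integrable_mx P M2.
  move=> i j; under eq_fun do rewrite M2E; apply: dom => [|w].
    by apply: measurable_funM; exact: dot_measurable.
  rewrite normrM /b -exprMn mulrC expr2 (mulrC (normF (v w))).
  by apply: ler_pM => //; exact: dot_col_le.
have HE : H = Emx P (fun w => M1 w - M2 w) by rewrite EmxB.
have iM := integrable_mxB iM1 iM2.
have LE G : L1 P X u (lincomb G Phi) = ((G^T *m H *m G) 0 0)%:E.
  rewrite HE -expectation_quad// /L1; congr expectation; apply/funext => w.
  rewrite grad_lincomb; last exact: Phi_C1.1.
  by rewrite sqr_proj_perp -quad_loss.
split=> //; split=> [|G].
  rewrite HE; apply/matrixP => i j; rewrite mxE [LHS]mxE [RHS]mxE.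
  congr (fine 'E_P[_]); apply/funext => w.
  rewrite mxE [RHS]mxE [X in _ + X]mxE [X in _ = _ + X]mxE.
  by rewrite !M1E !M2E dotC [dot (col i _) _ * _]mulrC.
by rewrite -lee_fin -LE expectation_ge0// => w; rewrite mulr_ge0 ?sqr_ge0.
Qed.
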